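(* The Gromov--Hausdorff distance between the cloud $[\Delta_1]$ of bounded metric spaces and the cloud $[\mathbb{R}]$ of the real line (with its usual metric) is infinite: $\big|[\Delta_1],[\mathbb{R}]\big|=\infty$.
   Context: All metric spaces are non-empty. $|X,Y|$ denotes the Gromov--Hausdorff distance between metric spaces $X,Y$ (possibly $\infty$). $\mathcal{GH}_0$ is the class of all metric spaces, where two spaces are identified if their Gromov--Hausdorff distance is zero. The equivalence classes of the relation $X\sim Y\Leftrightarrow |X,Y|<\infty$ on $\mathcal{GH}_0$ are called clouds; $[X]$ is the cloud containing $X$. $\Delta_1$ is the one-point metric space, so $[\Delta_1]$ is the cloud of all bounded metric spaces. A correspondence $R$ between clouds $[X]$ and $[Y]$ is a surjective multivalued mapping from $[X]$ to $[Y]$, identified with its graph: a relation between elements of $[X]$ and elements of $[Y]$ such that every element of $[X]$ is related to at least one element of $[Y]$ and every element of $[Y]$ is related to at least one element of $[X]$. The distortion is $\operatorname{dis}R=\sup\{\,\big||A,A'|-|B,B'|\big|:(A,B),(A',B')\in R\}$. The Gromov--Hausdorff distance between clouds is $\big|[X],[Y]\big|=\frac12\inf\{\operatorname{dis}R\}\in[0,\infty]$, the infimum over all correspondences $R$ between $[X]$ and $[Y]$. *)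

(* Defs.v *)
From HB Require Import structures.
From mathcomp Require Import all_boot all_order all_algebra.
From mathcomp Require Import all_classical all_reals.
From mathcomp Require Import ereal topology normedtype.
From mathcomp Require Import lra.

Set Implicit Arguments.
Unset Strict Implicit.
Unset Printing Implicit Defensive.

Import Order.TTheory GRing.Theory Num.Theory.

Local Open Scope classical_set_scope.
Local Open Scope ring_scope.

(* A metricType may be empty, hence the second field. *)
Record mspace (R : realType) := MSpace {
  mspace_sort :> metricType R ;
  mspace_inhabited : inhabited mspace_sort
}.

Definition isometric (R : realType) (X Y : metricType R) (f : X -> Y) : Prop :=
  forall x x', mdist (f x) (f x') = mdist x x'.

Definition hausdorff_dist (R : realType) (Z : metricType R) (A B : set Z) :
    \bar R :=
  ereal_inf [set r%:E | r in [set r : R | [/\ 0 < r,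
    A `<=` \bigcup_(b in B) ball b r & B `<=` \bigcup_(a in A) ball a r]]].

Definition gh_dist (R : realType) (X Y : metricType R) : \bar R :=
  ereal_inf [set e | exists (Z : metricType R) (f : X -> Z) (g : Y -> Z),
    [/\ isometric f, isometric g & e = hausdorff_dist (range f) (range g)]].

(* Subsets of the large types mspace R and GH0 R are plain predicates: the
   universe of the type argument of [set] lies below that of metricType R. *)

(* Points of GH_0 are the classes of metric spaces at zero distance. *)
Record GH0 (R : realType) := MkGH0 {
  GH0_mem : mspace R -> Prop ;
  GH0_memP : exists X : mspace R, GH0_mem = fun Y => gh_dist X Y = 0%E
}.

Definition gh_class (R : realType) (X : mspace R) : GH0 R :=
  @MkGH0 R (fun Y => gh_dist X Y = 0%E) (ex_intro _ X erefl).

Definition gh_repr (R : realType) (a : GH0 R) : mspace R :=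
  sval (cid (GH0_memP a)).

(* By gh0_distE below, this does not depend on the representatives. *)
Definition gh0_dist (R : realType) (a b : GH0 R) : \bar R :=
  gh_dist (gh_repr a) (gh_repr b).

Definition cloud (R : realType) (X : mspace R) : GH0 R -> Prop :=
  fun a => (gh0_dist (gh_class X) a < +oo)%E.

Definition correspondence (R : realType) (C D : GH0 R -> Prop)
    (Q : GH0 R -> GH0 R -> Prop) : Prop :=
  [/\ forall a b, Q a b -> C a /\ D b,
      forall a, C a -> exists b, Q a b &
      forall b, D b -> exists a, Q a b].

Definition distortion (R : realType) (Q : GH0 R -> GH0 R -> Prop) : \bar R :=
  ereal_sup [set e | exists a b a' b', [/\ Q a b, Q a' b' &
    e = `|gh0_dist a a' - gh0_dist b b'|%E]].

Definition cloud_dist (R : realType) (C D : GH0 R -> Prop) : \bar R :=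
  ((2^-1)%:E * ereal_inf [set e | exists Q,
    correspondence C D Q /\ e = distortion Q])%E.

(* The parameter lets instance inference find the ring of the metric. *)
Definition one_point (R : realType) : Type := unit.
HB.instance Definition _ (R : realType) := Choice.copy (one_point R) unit.

Section one_point_space.
Variable R : realType.

Let d (_ _ : one_point R) : R := 0.
Let dxx x : d x x = 0. Proof. by []. Qed.
Let d_pos x y : d x y = 0 -> x = y. Proof. by case: x; case: y. Qed.
Let d_sym x y : d x y = d y x. Proof. by []. Qed.
Let d_tri y x z : d x z <= d x y + d y z. Proof. by rewrite /d addr0. Qed.

HB.instance Definition _ := isMetric.Build R (one_point R) dxx d_pos d_sym d_tri.

Definition Delta1 : mspace R := @MSpace R (one_point R) (inhabits tt).
End one_point_space.

Definition real_line (R : realType) : mspace R := @MSpace R R^o (inhabits 0).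

Section gh_dist_theory.
Variable R : realType.
Implicit Types X Y Z : metricType R.

Lemma hausdorff_dist_ge0 Z (A B : set Z) : (0 <= hausdorff_dist A B)%E.
Proof. by apply: le_ereal_inf_tmp => _ [r [r0 _ _] <-]; rewrite lee_fin ltW. Qed.

Lemma gh_dist_ge0 X Y : (0 <= gh_dist X Y)%E.
Proof.
apply: le_ereal_inf_tmp => _ [Z [f [g [_ _ ->]]]]; exact: hausdorff_dist_ge0.
Qed.

Lemma gh_distxx X : gh_dist X X = 0%E.
Proof.
apply/eqP; rewrite eq_le gh_dist_ge0 andbT.
apply: (@le_trans _ _ (hausdorff_dist (range (@id X)) (range (@id X)))).
  by apply: ereal_inf_lbound; exists X, id, id.
apply/lee_addgt0Pr => e e0; rewrite add0e; apply: ereal_inf_lbound.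
by exists e => //; split=> // x _; exists x => //; exact: ballxx.
Qed.

Lemma gh_distC X Y : gh_dist X Y = gh_dist Y X.
Proof.
by congr ereal_inf; apply/seteqP; split=> e [Z [f [g [fi gi ->]]]];
  exists Z, g, f; split=> //; congr ereal_inf; congr image;
  apply/seteqP; split=> r [].
Qed.

Section glue.
Variables (X Y : metricType R) (c : X -> Y -> R).
Hypotheses (c_gt0 : forall x y, 0 < c x y)
  (c_l : forall x x' y, c x y <= mdist x x' + c x' y)
  (c_r : forall x y y', c x y <= c x y' + mdist y' y)
  (d_l : forall x x' y, mdist x x' <= c x y + c x' y)
  (d_r : forall x y y', mdist y y' <= c x y + c x y').

Let d (u v : X + Y) : R :=
  match u, v with
  | inl x, inl x' => mdist x x'
  | inl x, inr y => c x y
  | inr y, inl x => c x y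
  | inr y, inr y' => mdist y y'
  end.

Let dxx u : d u u = 0. Proof. by case: u => x /=; exact: mdistxx. Qed.

Let d_pos u v : d u v = 0 -> u = v.
Proof.
case: u v => [x|y] [x'|y'] /=.
- by move=> /mdist_positivity ->.
- by move=> c0; have := c_gt0 x y'; rewrite c0 ltxx.
- by move=> c0; have := c_gt0 x' y; rewrite c0 ltxx.
- by move=> /mdist_positivity ->.
Qed.

Let d_sym u v : d u v = d v u.
Proof. by case: u v => [x|y] [x'|y'] //=; exact: metric_sym. Qed.

Let d_tri v u w : d u w <= d u v + d v w.
Proof.
case: v u w => [x|y] [x'|y'] [x''|y''] /=; rewrite ?c_l ?c_r ?d_l ?d_r//;
  try exact: metric_triangle.
- by rewrite addrC metric_sym c_l.
- by rewrite addrC metric_sym c_r.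
Qed.

Lemma gh_dist_glue (r : R) : (forall x, exists y, c x y < r) ->
  (forall y, exists x, c x y < r) -> 0 < r -> (gh_dist X Y <= r%:E)%E.
Proof.
move=> hX hY r0.
pose Z : metricType R := HB.pack (X + Y)%type
  (isMetric.Build R (X + Y)%type dxx d_pos d_sym d_tri).
apply: (@le_trans _ _ (@hausdorff_dist R Z (range inl) (range inr))).
  by apply: ereal_inf_lbound; exists Z, inl, inr.
apply: ereal_inf_lbound; exists r => //; split=> //.
- move=> _ [x _ <-]; have [y xy] := hX x.
  by exists (inr y : Z); [exists y|rewrite ballEmdist].
- move=> _ [y _ <-]; have [x xy] := hY y.
  by exists (inl x : Z); [exists x|rewrite ballEmdist].
Qed.
End glue.

Lemma gh_dist_lt X Y (r : \bar R) : (gh_dist X Y < r)%E ->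
  exists (Z : metricType R) (f : X -> Z) (g : Y -> Z) (s : R),
    [/\ isometric f, isometric g & [/\ 0 < s, (s%:E < r)%E,
      forall x, exists y, mdist (f x) (g y) < s &
      forall y, exists x, mdist (f x) (g y) < s]].
Proof.
move=> /ereal_inf_lt[_ [Z [f [g [fi gi ->]]]]].
move=> /ereal_inf_lt[_ [s [s0 fg gf] <-] sr].
exists Z, f, g, s; split=> //; split=> // [x|y].
  have [|_ [y _ <-]] := fg (f x); first by exists x.
  by rewrite ballEmdist /= metric_sym => ?; exists y.
have [|_ [x _ <-]] := gf (g y); first by exists y.
by rewrite ballEmdist /= => ?; exists x.
Qed.

Lemma gh_dist_triangle X (Y : mspace R) Z :
  (gh_dist X Z <= gh_dist X Y + gh_dist Y Z)%E.
Proof.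
have [->|XYoo] := eqVneq (gh_dist X Y) +oo%E.
  by rewrite addye ?leey// gt_eqF// (lt_le_trans _ (gh_dist_ge0 _ _))// ltNy0.
have [->|YZoo] := eqVneq (gh_dist Y Z) +oo%E.
  by rewrite addey ?leey// gt_eqF// (lt_le_trans _ (gh_dist_ge0 _ _))// ltNy0.
have XYfin : gh_dist X Y \is a fin_num.
  by rewrite ge0_fin_numE ?gh_dist_ge0// lt_neqAle XYoo leey.
have YZfin : gh_dist Y Z \is a fin_num.
  by rewrite ge0_fin_numE ?gh_dist_ge0// lt_neqAle YZoo leey.
apply/lee_addgt0Pr => e e0.
have e30 : 0 < e / 3 by rewrite divr_gt0.
have /gh_dist_lt[U [f [g [r [fi gi [r0 rXY fg gf]]]]]] :
    (gh_dist X Y < gh_dist X Y + (e / 3)%:E)%E by rewrite lteDl// lte_fin.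
have /gh_dist_lt[V [h [k [s [hi ki [s0 sYZ hk kh]]]]]] :
    (gh_dist Y Z < gh_dist Y Z + (e / 3)%:E)%E by rewrite lteDl// lte_fin.
apply: (@le_trans _ _ (r + s + e / 3)%:E); last first.
  move: rXY sYZ; rewrite -(fineK XYfin) -(fineK YZfin) -!EFinD !lte_fin lee_fin.
  by move=> ? ?; lra.
pose F x z y := mdist (f x) (g y) + mdist (h y) (k z).
pose m x z := inf (range (F x z)).
have F_ge0 x z y : 0 <= F x z y by rewrite addr_ge0// mdist_ge0.
have le_m x z y : m x z <= F x z y.
  apply: ge_inf; last by exists y.
  by exists 0 => _ [y' _ <-].
have m_ge x z t : (forall y, t <= F x z y) -> t <= m x z.
  move=> tF; apply: lb_le_inf => [|_ [y _ <-]//].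
  by have [y] := mspace_inhabited Y; exists (F x z y), y.
apply: (@gh_dist_glue X Z (fun x z => m x z + e / 3)).
- by move=> x z; rewrite ltr_wpDl// m_ge.
- move=> x x' z; suff : m x z - mdist x x' <= m x' z by lra.
  apply: (m_ge) => y; have := le_m x z y; rewrite /F -fi.
  by have := metric_triangle (f x) (f x') (g y); lra.
- move=> x z z'; suff : m x z - mdist z' z <= m x z' by lra.
  apply: (m_ge) => y; have := le_m x z y; rewrite /F -ki.
  by have := metric_triangle (h y) (k z') (k z); lra.
- move=> x x' z; suff : mdist x x' - m x' z <= m x z by lra.
  apply: (m_ge) => y; suff : mdist x x' - F x z y <= m x' z by lra.
  apply: (m_ge) => y'; rewrite /F -fi.
  have := metric_triangle (f x) (g y) (f x').
  have := metric_triangle (g y) (g y') (f x').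
  have := metric_triangle (h y) (k z) (h y').
  by rewrite gi hi (metric_sym (k z) (h y')) (metric_sym (g y') (f x')); lra.
- move=> x z z'; suff : mdist z z' - m x z' <= m x z by lra.
  apply: (m_ge) => y; suff : mdist z z' - F x z y <= m x z' by lra.
  apply: (m_ge) => y'; rewrite /F -ki.
  have := metric_triangle (k z) (h y) (k z').
  have := metric_triangle (h y) (h y') (k z').
  have := metric_triangle (g y) (f x) (g y').
  by rewrite gi hi (metric_sym (k z) (h y)) (metric_sym (g y) (f x)); lra.
- move=> x; have [y xy] := fg x; have [z yz] := hk y.
  by exists z; have := le_m x z y; rewrite /F; lra.
- move=> z; have [y yz] := kh z; have [x xy] := gf y.
  by exists x; have := le_m x z y; rewrite /F; lra.
- by lra.
Qed.

Lemma gh_repr_class (X : mspace R) : gh_dist X (gh_repr (gh_class X)) = 0%E.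
Proof.
rewrite /gh_repr; case: cid => Y /= XY.
suff : gh_dist X X = 0%E by rewrite [_ = _](congr1 (@^~ X) XY) gh_distC.
exact: gh_distxx.
Qed.

Lemma gh0_distE (X Y : mspace R) :
  gh0_dist (gh_class X) (gh_class Y) = gh_dist X Y.
Proof.
have H (A B A' B' : mspace R) : gh_dist A A' = 0%E -> gh_dist B B' = 0%E ->
    (gh_dist A B <= gh_dist A' B')%E.
  move=> A0 B0; apply: (le_trans (gh_dist_triangle A A' B)).
  rewrite A0 add0e; apply: (le_trans (gh_dist_triangle A' B' B)).
  by rewrite (gh_distC B') B0 adde0.
apply/eqP; rewrite eq_le; apply/andP; split; apply: (H);
  by rewrite ?gh_repr_class // gh_distC gh_repr_class.
Qed.

Lemma gh_class_eq (X Y : mspace R) :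
  gh_class X = gh_class Y <-> gh_dist X Y = 0%E.
Proof.
split=> [XY|XY].
  have := gh_distxx Y.
  by rewrite [_ = _](congr1 (fun a => GH0_mem a Y) (esym XY)).
have H (A B C : mspace R) : gh_dist A B = 0%E -> gh_dist B C = 0%E ->
    gh_dist A C = 0%E.
  move=> AB BC; apply/eqP; rewrite eq_le gh_dist_ge0 andbT.
  by rewrite (le_trans (gh_dist_triangle _ B _))// AB BC adde0.
have E : (fun T : mspace R => gh_dist X T = 0%E) =
      (fun T : mspace R => gh_dist Y T = 0%E).
  apply/funext => Z; apply/propext; split; apply: (H) => //.
  by rewrite gh_distC.
rewrite /gh_class; move: (ex_intro _ _ _) (ex_intro _ _ _).
by rewrite E => p q; congr MkGH0; exact: Prop_irrelevance.
Qed.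

End gh_dist_theory.

(* Main.v *)
Require Import Defs.
From mathcomp Require Import all_boot all_order all_algebra.
From mathcomp Require Import all_classical all_reals.
From HB Require Import structures.
From mathcomp Require Import ereal topology.
From mathcomp Require Import zify lra.

(** Any two bounded spaces satisfy the ultrametric-like inequality
    [|X, X'| <= max(|X, Delta_1|, |X', Delta_1|)].  A correspondence of finite
    distortion between the two clouds would carry it over to [[R]], up to an
    additive constant, with [Delta_1] replaced by some space at finite distance
    from the line, hence by the line itself.  It fails there: the scaled
    integers [c Z] and the l1-product of the line with two points at distance
    [c] are both at distance at most [3 c / 4] from the line, but at distance at
    least [7 c / 8] from each other, and [c] is arbitrary.  The lower bound
    comes from counting: below it, points of the product that are [7 c / 4]
    apart would be matched with distinct integers, and there are too many such
    points in a long segment. *)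

Set Implicit Arguments.
Unset Strict Implicit.
Unset Printing Implicit Defensive.

Import Order.TTheory GRing.Theory Num.Theory.

Local Open Scope classical_set_scope.
Local Open Scope ring_scope.

(** * Spread of distinct integers *)

Lemma int_inj_spread (M : nat) (n : 'I_M.+2 -> int) : injective n ->
  exists i j, M.+1%:Z <= `|n i - n j|.
Proof.
move=> n_inj; apply: contrapT => small.
have lt_M i j : `|n i - n j| < M.+1%:Z.
  by rewrite ltNge; apply/negP => ?; apply: small; exists i, j.
(* Pigeonhole: relative to the least value, the absolute offsets still determine the integers, and
   they would inject [M.+2] indices into [M.+1] values. *)
case: (@Order.TotalTheory.arg_minP _ _ _ ord0 xpredT n isT) => i0 _ i0_min.
have bnd i : (`|n i - n i0|%N < M.+1)%N by have := lt_M i i0; lia.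
pose g i := Ordinal (bnd i).
have : injective g.
  move=> i j /(congr1 val) /= gij; apply: n_inj.
  by have := i0_min i isT; have := i0_min j isT; lia.
by move=> /leq_card; rewrite !card_ord; lia.
Qed.

(** Moves distances between indices to [int], where [lia] applies. *)
Lemma normr_natB (R : numDomainType) (i j : nat) :
  `|i%:R - j%:R| = `|i%:Z - j%:Z|%:~R :> R.
Proof. by rewrite intr_norm intrB. Qed.

(* The alias keeps the topologies that the library puts on [T] out of the way. *)
Definition dist_carrier (R : realType) (T : choiceType) (d : T -> T -> R) :
  Type := T.
HB.instance Definition _ (R : realType) (T : choiceType) (d : T -> T -> R) :=
  Choice.copy (dist_carrier d) T.

(** * The scaled integers and the doubled line *)

Section spaces.
Variable R : realType.

Section mspace_of_dist.
Variables (T : choiceType) (d : T -> T -> R) (t0 : T).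
Hypotheses (dxx : forall x, d x x = 0)
  (d_pos : forall x y, d x y = 0 -> x = y)
  (d_sym : forall x y, d x y = d y x)
  (d_tri : forall y x z, d x z <= d x y + d y z).

Definition mspace_of_dist : mspace R :=
  let X : metricType R := HB.pack (dist_carrier d)
    (isMetric.Build R (dist_carrier d) dxx d_pos d_sym d_tri) in
  @MSpace R X (inhabits t0).
End mspace_of_dist.

Variable c : R.
Hypothesis c_gt0 : 0 < c.

Let dZ (m n : int) : R := c * `|m%:~R - n%:~R|.
Let dZxx m : dZ m m = 0. Proof. by rewrite /dZ subrr normr0 mulr0. Qed.
Let dZ_pos m n : dZ m n = 0 -> m = n.
Proof.
move/eqP; rewrite mulf_eq0 gt_eqF//= normr_eq0 subr_eq0 eqr_int.
by move/eqP.
Qed.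
Let dZ_sym m n : dZ m n = dZ n m. Proof. by rewrite /dZ distrC. Qed.
Let dZ_tri n m p : dZ m p <= dZ m n + dZ n p.
Proof. by rewrite /dZ -mulrDr ler_pM2l// ler_distD. Qed.

Definition scaled_int : mspace R :=
  mspace_of_dist 0 dZxx dZ_pos dZ_sym dZ_tri.

Let dL (u v : R * bool) : R := `|u.1 - v.1| + c * (u.2 != v.2)%:R.
Let dLxx u : dL u u = 0.
Proof. by rewrite /dL subrr normr0 eqxx mulr0 addr0. Qed.
Let dL_pos u v : dL u v = 0 -> u = v.
Proof.
have c0 := c_gt0.
case: u v => [x i] [y j]; rewrite /dL /=; have := normr_ge0 (x - y).
case: eqVneq => [-> _|_] /=; last by move=> ? /eqP; rewrite gt_eqF//; lra.
by rewrite mulr0 addr0 => /eqP; rewrite normr_eq0 subr_eq0 => /eqP ->.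
Qed.
Let dL_sym u v : dL u v = dL v u.
Proof. by rewrite /dL distrC eq_sym. Qed.
Let dL_tri v u w : dL u w <= dL u v + dL v w.
Proof.
have c0 := c_gt0.
case: u v w => [x i] [y j] [z k]; rewrite /dL /=; have := ler_distD y x z.
by case: i; case: j; case: k => /=; lra.
Qed.

Definition double_line : mspace R :=
  mspace_of_dist (0, false) dLxx dL_pos dL_sym dL_tri.

Lemma mdist_scaled_int (m n : scaled_int) :
  mdist m n = c * `|(m : int)%:~R - (n : int)%:~R|.
Proof. by []. Qed.

Lemma mdist_double_line (u v : double_line) :
  mdist u v = `|(u : R * bool).1 - (v : R * bool).1|
    + c * ((u : R * bool).2 != (v : R * bool).2)%:R.
Proof. by []. Qed.

Lemma mdist_real_line (x y : real_line R) :
  mdist x y = `|(x : R) - (y : R)|.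
Proof. by rewrite distrC. Qed.

Lemma gh_dist_double_line_line :
  (gh_dist double_line (real_line R) <= (3 / 4 * c)%:E)%E.
Proof.
have c0 := c_gt0.
(* The offset [c / 2] is half the gap between the two copies of a point, whose images in the line
   coincide; [3 / 4 * c] leaves room for strictness. *)
apply: (@gh_dist_glue R double_line (real_line R)
  (fun u x => `|(u : R * bool).1 - (x : R)| + c / 2)).
- by move=> u x; have := normr_ge0 ((u : R * bool).1 - (x : R)); lra.
- move=> u v x; rewrite mdist_double_line.
  have := ler_distD (v : R * bool).1 (u : R * bool).1 (x : R).
  by case: (_ != _) => /=; lra.
- move=> u x y; rewrite mdist_real_line.
  by have := ler_distD (y : R) (u : R * bool).1 (x : R); lra.
- move=> u v x; rewrite mdist_double_line.
  have := ler_distD (x : R) (u : R * bool).1 (v : R * bool).1.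
  by rewrite (distrC (x : R)); case: (_ != _) => /=; lra.
- move=> u x y; rewrite mdist_real_line.
  have := ler_distD (u : R * bool).1 (x : R) (y : R).
  by rewrite (distrC (x : R) (u : R * bool).1); lra.
- by move=> u; exists (u : R * bool).1; rewrite subrr normr0; lra.
- by move=> x; exists ((x : R), false) => /=; rewrite subrr normr0; lra.
- by lra.
Qed.

Lemma gh_dist_scaled_int_line :
  (gh_dist scaled_int (real_line R) <= (3 / 4 * c)%:E)%E.
Proof.
have c0 := c_gt0.
(* The offset [c / 8] only keeps cross distances positive; with a rounding error of at most [c / 2]
   the total stays below [3 / 4 * c]. *)
apply: (@gh_dist_glue R scaled_int (real_line R)
  (fun m x => `|c * (m : int)%:~R - (x : R)| + c / 8)).
- by move=> m x; have := normr_ge0 (c * (m : int)%:~R - (x : R)); lra.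
all: have dE (m n : scaled_int) :
    mdist m n = `|c * (m : int)%:~R - c * (n : int)%:~R|
  by rewrite mdist_scaled_int -mulrBr normrM gtr0_norm.
- move=> m n x; rewrite dE.
  by have := ler_distD (c * (n : int)%:~R) (c * (m : int)%:~R) (x : R); lra.
- move=> m x y; rewrite mdist_real_line.
  by have := ler_distD (y : R) (c * (m : int)%:~R) (x : R); lra.
- move=> m n x; rewrite dE.
  have := ler_distD (x : R) (c * (m : int)%:~R) (c * (n : int)%:~R).
  by rewrite (distrC (x : R)); lra.
- move=> m x y; rewrite mdist_real_line.
  have := ler_distD (c * (m : int)%:~R) (x : R) (y : R).
  by rewrite (distrC (x : R) (c * (m : int)%:~R)); lra.
- by move=> m; exists (c * (m : int)%:~R); rewrite subrr normr0; lra.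
(* A nearest integer to [x / c]. *)
- move=> x; exists (Num.floor ((x : R) / c + 2^-1) : int).
  set k := Num.floor _.
  have k1 : k%:~R <= (x : R) / c + 2^-1 by exact: floor_le_tmp.
  have k2 : (x : R) / c + 2^-1 < k%:~R + 1.
    by rewrite -[1]/(1%:~R) -intrD floorD1_gt.
  have xE : (x : R) = c * ((x : R) / c) by rewrite mulrC divfK// gt_eqF.
  rewrite {1}xE -mulrBr normrM (gtr0_norm c_gt0).
  have : `|k%:~R - (x : R) / c| <= 2^-1 by rewrite ler_norml; lra.
  by nra.
- by lra.
Qed.

Lemma gh_dist_double_line_scaled_int :
  ((7 / 8 * c)%:E <= gh_dist double_line scaled_int)%E.
Proof.
have c0 := c_gt0.
rewrite leNgt; apply/negP.
move=> /gh_dist_lt[Z [f [g [s [fi gi [s0]]]]]]; rewrite lte_fin => sc fg _.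
(* The points alternate between the two lines: neighbours are [15 / 8 * c] apart, all other pairs at
   least two steps, that is [7 / 4 * c]. *)
pose p (i : 'I_32) : double_line := (7 / 8 * c * (i : nat)%:R, odd i).
have [n pn] := choice (fun i => fg (p i)).
have pE i j : mdist (p i) (p j) =
    7 / 8 * c * `|(i : nat)%:R - (j : nat)%:R| + c * (odd i != odd j)%:R.
  by rewrite mdist_double_line /= -mulrBr normrM gtr0_norm//; lra.
have n_inj : injective (n : 'I_32 -> int).
  move=> i j nij; apply/eqP/negPn/negP => ij.
  have : mdist (p i) (p j) < 7 / 4 * c.
    rewrite -fi; have := metric_triangle (f (p i)) (g (n i)) (f (p j)).
    rewrite (metric_sym (g (n i))); have := pn i; have := pn j.
    by rewrite nij; lra.
  rewrite pE; have [oij|oij] := eqVneq (odd i) (odd j) => /=.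
    have : 2 <= `|(i : nat)%:R - (j : nat)%:R| :> R.
      rewrite normr_natB -[2]/(2%:Z%:~R) ler_int.
      by move: ij; rewrite -val_eqE /=; lia.
    by nra.
  have : 1 <= `|(i : nat)%:R - (j : nat)%:R| :> R.
    rewrite normr_natB -[1]/(1%:Z%:~R) ler_int.
    by move: ij; rewrite -val_eqE /=; lia.
  by nra.
(* Two of the 32 integers are at distance at least [31 * c], whereas the points allow less than
   [(7 / 8 * 31 + 1 + 7 / 4) * c], which is below [30 * c]. *)
have [i [j]] := @int_inj_spread 30 n n_inj.
rewrite -(ler_int R) intr_norm intrB => nij.
have : mdist (n i) (n j) < mdist (p i) (p j) + 7 / 4 * c.
  rewrite -fi -gi; have := pn i; have := pn j.
  have := metric_triangle (g (n i)) (f (p i)) (g (n j)).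
  have := metric_triangle (f (p i)) (f (p j)) (g (n j)).
  by rewrite (metric_sym (g (n i)) (f (p i))); lra.
rewrite pE mdist_scaled_int.
have : `|(i : nat)%:R - (j : nat)%:R| <= 31 :> R.
  rewrite normr_natB -[31]/(31%:Z%:~R) ler_int.
  by have := ltn_ord i; have := ltn_ord j; lia.
by case: (_ != _) => /=; nra.
Qed.

End spaces.

(** * Distances among bounded spaces, and distortion *)

Section bounded_cloud.
Variable R : realType.
Implicit Types a b : GH0 R.

Lemma gh0_dist_triangle a b a' :
  (gh0_dist a a' <= gh0_dist a b + gh0_dist b a')%E.
Proof. exact: gh_dist_triangle. Qed.

Lemma gh_dist_Delta1_lt (X : metricType R) (r : R) :
  (gh_dist X (Delta1 R) < r%:E)%E ->
  exists2 s : R, 0 < s < r & forall x x' : X, mdist x x' <= 2 * s.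
Proof.
move=> /gh_dist_lt[Z [f [g [s [fi _ [s0 sr fg _]]]]]].
exists s; first by rewrite s0 -lte_fin.
move=> x x'; have [[] xs] := fg x; have [[] x's] := fg x'.
rewrite -fi; have := metric_triangle (f x) (g tt) (f x').
by rewrite (metric_sym (g tt)); lra.
Qed.

(* The two spaces are glued with all cross distances equal. *)
Lemma gh_dist_Delta1_ultra (X Y : mspace R) (r : R) :
  (gh_dist X (Delta1 R) < r%:E)%E -> (gh_dist Y (Delta1 R) < r%:E)%E ->
  (gh_dist X Y <= r%:E)%E.
Proof.
move=> /gh_dist_Delta1_lt[s /andP[s0 sr] sX].
move=> /gh_dist_Delta1_lt[t /andP[t0 tr] tY].
have [x0] := mspace_inhabited X; have [y0] := mspace_inhabited Y.
(* At least half of either diameter, as triangles with two vertices in one space require. *)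
pose m := Num.max s t.
have sm : s <= m by rewrite le_max lexx.
have tm : t <= m by rewrite le_max lexx orbT.
have mr : m < r by rewrite gt_max sr.
apply: (@gh_dist_glue R X Y (fun _ _ => m)).
- by move=> _ _; lra.
- by move=> x x' _; have := mdist_ge0 x x'; lra.
- by move=> _ y y'; have := mdist_ge0 y' y; lra.
- by move=> x x' _; have := sX x x'; lra.
- by move=> _ y y'; have := tY y y'; lra.
- by exists y0.
- by exists x0.
- by lra.
Qed.

Lemma gh0_dist_Delta1_ultra a b (r : R) :
  (gh0_dist a (gh_class (Delta1 R)) < r%:E)%E ->
  (gh0_dist b (gh_class (Delta1 R)) < r%:E)%E ->
  (gh0_dist a b <= r%:E)%E.
Proof.
have H a' : (gh0_dist a' (gh_class (Delta1 R)) < r%:E)%E ->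
    (gh_dist (gh_repr a') (Delta1 R) < r%:E)%E.
  apply: le_lt_trans; apply: le_trans (gh_dist_triangle _
    (gh_repr (gh_class (Delta1 R))) _) _.
  by rewrite (gh_distC _ (Delta1 R)) gh_repr_class adde0.
by move=> /H ? /H ?; exact: gh_dist_Delta1_ultra.
Qed.

(* In [\bar R] the difference [+oo - +oo] is [-oo], of absolute value [+oo], so
   finite distortion forces all distances to be finite. *)
Lemma distortion_le (Q : GH0 R -> GH0 R -> Prop) (E : R) a b a' b' :
  (distortion Q <= E%:E)%E -> Q a b -> Q a' b' ->
  exists x y : R, [/\ gh0_dist a a' = x%:E, gh0_dist b b' = y%:E
    & `|x - y| <= E].
Proof.
move=> QE Qab Qab'.
have : (`|gh0_dist a a' - gh0_dist b b'| <= E%:E)%E.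
  by apply: le_trans QE; apply: ereal_sup_ubound; exists a, b, a', b'.
case: (gh0_dist a a') => [x| |]; case: (gh0_dist b b') => [y| |] //=.
by rewrite lee_fin => xyE; exists x, y.
Qed.

End bounded_cloud.

(** * Infinite distortion of every correspondence *)

Lemma distortion_Delta1_line (R : realType) (Q : GH0 R -> GH0 R -> Prop) :
  correspondence (cloud (Delta1 R)) (cloud (real_line R)) Q ->
  distortion Q = +oo%E.
Proof.
move=> [QC Q1 Q2]; apply: contrapT => /eqP Qfin.
have [E QE] : exists E : R, (distortion Q <= E%:E)%E.
  case: (distortion Q) Qfin => [e| |] // _; first by exists e.
  by exists 0; rewrite leNye.
have [b0 Qb0] : exists b0, Q (gh_class (Delta1 R)) b0.
  by apply: Q1; rewrite /cloud gh0_distE gh_distxx ltry.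
have E0 : 0 <= E.
  have [x [y [_ _]]] := distortion_le QE Qb0 Qb0.
  exact: le_trans (normr_ge0 _).
have [t b0t] : exists t : R, (gh0_dist (gh_class (real_line R)) b0 <= t%:E)%E.
  have [_] := QC _ _ Qb0; rewrite /cloud.
  by case: gh0_dist => [t| |] // _; [exists t|exists 0; rewrite leNye].
have t0 : 0 <= t by rewrite -lee_fin; apply: le_trans b0t; exact: gh_dist_ge0.
(* Chosen so that the gap [c / 8] between [7 / 8 * c] and [3 / 4 * c] exceeds the total error
   [t + 2 * E + 1]. *)
pose c := 8 * (t + 2 * E + 2).
have c_gt0 : 0 < c by rewrite /c; lra.
(* Passing from the line to [b0] costs [t], pulling back along [Q] costs [E], and the [1] makes the
   bound strict. *)
have near_b0 (Y : mspace R) : (gh_dist Y (real_line R) <= (3 / 4 * c)%:E)%E ->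
    exists2 a, Q a (gh_class Y) &
      (gh0_dist a (gh_class (Delta1 R)) < (3 / 4 * c + t + E + 1)%:E)%E.
  move=> YR; have [a Qa] : exists a, Q a (gh_class Y).
    apply: Q2; rewrite /cloud gh0_distE gh_distC.
    exact: le_lt_trans YR (ltry _).
  exists a => //; have [x [y [-> yE]]] := distortion_le QE Qa Qb0.
  rewrite ler_norml lte_fin => /andP[_ xyE].
  have : (y%:E <= (3 / 4 * c + t)%:E)%E.
    rewrite -yE EFinD; apply: le_trans (gh0_dist_triangle _
      (gh_class (real_line R)) _) _.
    by rewrite gh0_distE leeD.
  by rewrite lee_fin; lra.
have [a Qa aE] := near_b0 _ (gh_dist_double_line_line c_gt0).
have [a' Qa' a'E] := near_b0 _ (gh_dist_scaled_int_line c_gt0).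
have [x [y [xE yE]]] := distortion_le QE Qa Qa'.
have := gh0_dist_Delta1_ultra aE a'E.
have := gh_dist_double_line_scaled_int c_gt0.
rewrite -gh0_distE xE yE !lee_fin ler_norml /c => y_ge x_le /andP[xy _].
by clear -y_ge x_le xy; lra.
Qed.

Theorem corollary3 (R : realType) :
  cloud_dist (cloud (Delta1 R)) (cloud (real_line R)) = +oo%E.
Proof.
rewrite /cloud_dist (_ : ereal_inf _ = +oo%E).
  by rewrite gt0_muley// lte_fin invr_gt0.
by apply/ereal_inf_pinfty => _ [Q [Qc ->]]; exact: distortion_Delta1_line.
Qed.
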